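(* There is an absolute constant $C>0$ such that the following holds. Let $T$ be a tree of maximum degree $\Delta\ge 2$ and radius $h$. Then the cat can localize the mouse up to distance $4\Delta-6$ within time $C\,h\,\Delta$ on $T$.
   Context: All graphs are finite, simple, undirected and connected. The game is played on a graph $G$ in discrete rounds $i=1,2,\ldots$. A game on $G$ is a pair of sequences $((m_i)_{i\in\mathbb N},(c_i)_{i\in\mathbb N})$ of vertices of $G$ such that $m_i\in N_G[m_{i-1}]$ (the closed neighborhood) for every $i\ge 2$; the $m_i$ are the mouse's positions and the $c_i$ (arbitrary vertices) are the cat's probes. Let $d_i=\mathrm{dist}_G(c_i,m_i)$, and for $i\ge2$ let $b_i=1$ if $d_i\le d_{i-1}$ and $b_i=0$ if $d_i>d_{i-1}$. The set $M_i$ is the set of all vertices $u$ for which there exist vertices $\tilde m_1,\ldots,\tilde m_i$ with $\tilde m_i=u$, $\tilde m_j\in N_G[\tilde m_{j-1}]$ for all $2\le j\le i$, and $\mathrm{dist}_G(c_j,\tilde m_j)\le \mathrm{dist}_G(c_{j-1},\tilde m_{j-1})$ if and only if $b_j=1$, for all $2\le j\le i$. For a vertex set $M$, $\mathrm{rad}_G(M)=\min_{u\in V(G)}\max_{m\in M}\mathrm{dist}_G(u,m)$. A strategy for the cat is a triple $(c_1,c_2;f)$ with $c_1,c_2\in V(G)$ and $f:\bigcup_{i\in\mathbb N}\{0,1\}^i\to V(G)$; the cat follows it in a game if its first two probes are $c_1,c_2$ and $c_{i+1}=f(b_2,\ldots,b_i)$ for all $i\ge2$. The cat can localize the mouse up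 to distance $d$ within time $t$ on $G$ if there is a strategy $\sigma$ such that for every game on $G$ in which the cat follows $\sigma$, there is a positive integer $i\le t$ with $\mathrm{rad}_G(M_i)\le d$. *)

(* Defs.v *)
From mathcomp Require Import all_boot.
From Stdlib Require Import Classical ClassicalEpsilon.
Set Implicit Arguments. Unset Strict Implicit. Unset Printing Implicit Defensive.

Definition simple_graph (T : finType) (e : rel T) : Prop :=
  symmetric e /\ irreflexive e.

Definition connected_graph (T : finType) (e : rel T) : Prop :=
  forall x y : T, connect e x y.

Definition acyclic (T : finType) (e : rel T) : Prop :=
  forall s : seq T, uniq s -> 3 <= size s -> ~~ cycle e s.

Definition is_tree (T : finType) (e : rel T) : Prop :=
  simple_graph e /\ connected_graph e /\ acyclic e.

Definition cnbr (T : finType) (e : rel T) (x y : T) : bool := (y == x) || e x y.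

Fixpoint ball (T : finType) (e : rel T) (k : nat) (x : T) : {set T} :=
  match k with
  | 0 => [set x]
  | k'.+1 => ball e k' x :|: [set z | [exists y in ball e k' x, e y z]]
  end.

(* graph distance: least k with y in the k-ball of x (for connected graphs
   such k < #|T| exists; otherwise the value is #|T|.+1, irrelevant here) *)
Definition dist (T : finType) (e : rel T) (x y : T) : nat :=
  find (fun k => y \in ball e k x) (iota 0 #|T|.+1).

Definition degree (T : finType) (e : rel T) (v : T) : nat := #|[set u | e v u]|.
Definition maxdeg (T : finType) (e : rel T) : nat := \max_(v : T) degree e v.

(* rad_G(M) = min_u max_{m in M} dist(u,m)  (T assumed nonempty; the seed
   #|T| of the min is never attained in a nonempty connected graph since any
   max distance is < #|T|). *)
Definition radS (T : finType) (e : rel T) (M : {set T}) : nat :=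
  \big[minn/#|T|]_(u : T) \max_(m in M) dist e u m.

Definition radius (T : finType) (e : rel T) : nat := radS e [set: T].

Definition pbool (P : Prop) : bool :=
  if excluded_middle_informative P then true else false.

(* Games are indexed from 1; values at index 0 are irrelevant. *)
Definition is_game (T : finType) (e : rel T) (m c : nat -> T) : Prop :=
  forall i, 2 <= i -> cnbr e (m i.-1) (m i).

Definition dd (T : finType) (e : rel T) (m c : nat -> T) (i : nat) : nat :=
  dist e (c i) (m i).

Definition bb (T : finType) (e : rel T) (m c : nat -> T) (i : nat) : bool :=
  dd e m c i <= dd e m c i.-1.

Definition Mset (T : finType) (e : rel T) (m c : nat -> T) (i : nat) : {set T} :=
  [set u | pbool (exists mt : nat -> T, mt i = u /\
       forall j, 2 <= j <= i ->
         cnbr e (mt j.-1) (mt j) /\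
         (dist e (c j) (mt j) <= dist e (c j.-1) (mt j.-1)) = bb e m c j)].

(* strategy (c1, c2, f), f defined on bit sequences (its value on [::] unused) *)
Definition follows (T : finType) (e : rel T) (m c : nat -> T)
  (c1 c2 : T) (f : seq bool -> T) : Prop :=
  c 1 = c1 /\ c 2 = c2 /\
  forall i, 2 <= i -> c i.+1 = f [seq bb e m c j | j <- iota 2 i.-1].

Definition can_localize (T : finType) (e : rel T) (d t : nat) : Prop :=
  exists (c1 c2 : T) (f : seq bool -> T),
    forall m c : nat -> T, is_game e m c -> follows e m c c1 c2 f ->
      exists i, 1 <= i <= t /\ radS e (Mset e m c i) <= d.

(* Main.v *)
(* Probing a neighbour v of u and then another neighbour w of u tells that the
   mouse is not in the branch of v at u (answer 1) or not in that of w (answer 0).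
   So with D the maximum degree, within 2(D-1) rounds a knockout tournament among
   the neighbours of u leaves one branch W such that the mouse is in W or within
   2D-4 of u, because an eliminated branch can only be re-entered through u.
   Scan first at the centre, then at the neighbour of u in W, and so on: the
   scanned vertices move away from the centre until some scan at w points back to
   the previously scanned u. At that time the mouse is within
   (2D-4) + 2(D-1) = 4D-6 of u. There are at most h+1 scans. *)
Require Import Defs.
From mathcomp Require Import all_boot zify.
From Stdlib Require Import ClassicalEpsilon.
Set Implicit Arguments. Unset Strict Implicit. Unset Printing Implicit Defensive.

(** * Distances realised by paths *)

Section Distance.
Variables (T : finType) (e : rel T).
Hypotheses (sym_e : symmetric e) (conn_e : connected_graph e).
Local Notation d := (dist e).

Lemma in_ball_path k x y :
  reflect (exists p, [/\ path e x p, last x p = y & size p <= k])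
          (y \in ball e k x).
Proof.
elim: k y => [|k IH] y /=.
  rewrite inE; apply: (iffP eqP) => [->|]; first by exists [::].
  by case=> -[|z p] [].
rewrite !inE; apply: (iffP orP).
  case=> [/IH[p [h1 h2 h3]]|]; first by exists p; split=> //; apply: leqW.
  case/existsP=> z /andP[/IH[p [h1 h2 h3]] ezy].
  by exists (rcons p y); rewrite rcons_path last_rcons size_rcons h1 h2.
case=> p; case: (lastP p) => [|q z].
  by case=> _ /= <- _; left; apply/IH; exists [::].
rewrite rcons_path last_rcons size_rcons => -[/andP[h1 h2] <- h3].
right; apply/existsP; exists (last x q); rewrite h2 andbT.
by apply/IH; exists q.
Qed.

Lemma dist_le_size x p : path e x p -> d x (last x p) <= size p.
Proof.
move=> pp; rewrite /dist; set P := (fun k => _).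
have [lt|ge] := ltnP (size p) #|T|.+1; last first.
  by apply: leq_trans (find_size _ _) _; rewrite size_iota.
rewrite leqNgt; apply/negP => /(before_find 0).
by rewrite nth_iota // add0n => /in_ball_path []; exists p.
Qed.

Lemma dist_path x y :
  exists p, [/\ path e x p, last x p = y, size p = d x y & d x y < #|T|].
Proof.
have [q pq lq] := connectP (conn_e x y).
case/shortenP: pq lq => p pp up _ lp.
have sp : size p < #|T|.
  by rewrite -/(size (x :: p)) -(card_uniqP up) max_card.
have hs : has (fun k => y \in ball e k x) (iota 0 #|T|.+1).
  apply/hasP; exists (size p); first by rewrite mem_iota; lia.
  by apply/in_ball_path; exists p.
have := nth_find 0 hs; move: hs; rewrite has_find size_iota => hf.
rewrite nth_iota // add0n -/(d x y) => /in_ball_path[r [pr lr sr]].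
exists r; split=> //.
  by apply/eqP; rewrite eqn_leq sr -lr dist_le_size.
by apply: leq_ltn_trans sp; rewrite lp dist_le_size.
Qed.

Lemma dist_lt_card x y : d x y < #|T|.
Proof. by case: (dist_path x y) => p []. Qed.

Lemma distC x y : d x y = d y x.
Proof.
suff le a b : d b a <= d a b by apply/eqP; rewrite eqn_leq !le.
have [p [pp <- <- _]] := dist_path a b.
have := @dist_le_size (last a p) (rev (belast a p)).
rewrite rev_path size_rev size_belast.
have -> : last (last a p) (rev (belast a p)) = a.
  by case: p {pp} => //= z p; rewrite rev_cons last_rcons.
by apply; rewrite (eq_path (e' := e)) // => ? ?; rewrite sym_e.
Qed.

Lemma dist0 x : d x x = 0.
Proof. by apply/eqP; rewrite -leqn0 (@dist_le_size x [::]). Qed.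

Lemma dist_eq0 x y : d x y = 0 -> x = y.
Proof. by have [[|z p] [_ /= <- <- _]] := dist_path x y. Qed.

Lemma dist_edge z x y : e x y -> d z y <= (d z x).+1.
Proof.
have [p [pp <- <- _]] := dist_path z x => exy.
have := @dist_le_size z (rcons p y).
by rewrite rcons_path pp exy last_rcons size_rcons; apply.
Qed.

Lemma closer_neighbor z x : 0 < d z x -> exists2 y, e x y & d z x = (d z y).+1.
Proof.
rewrite distC; have [[|y p] [/= pp lp sp _]] := dist_path x z; first by lia.
case/andP: pp => exy pp _; exists y => //; apply/eqP.
rewrite eqn_leq [d x z]distC dist_edge ?(sym_e y) //= -[d z x]distC -sp /=.
by rewrite ltnS -lp distC dist_le_size.
Qed.

(** Both vertices descend to [z] through vertices ever closer to it; joined at [z] and shortened,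
    the descents stay below level [k]. Such paths close the cycles that a tree forbids. *)
Lemma below_path z k x y : d z x < k -> d z y < k ->
  exists p, [/\ path e x p, last x p = y, uniq (x :: p)
              & all (fun t => d z t < k) (x :: p)].
Proof.
move=> xk yk; pose r := [rel a b | [&& e a b, d z a < k & d z b < k]].
have to_z a : d z a < k -> connect r a z.
  have [n] := ubnP (d z a); elim: n a => // n IH a an ak.
  have [/dist_eq0->|/closer_neighbor[b eab Eab]] := posnP (d z a).
    exact: connect0.
  apply: connect_trans (connect1 _) (IH b _ _); try lia.
  by rewrite /= eab ak; lia.
have rs : symmetric r by move=> a b /=; rewrite sym_e; case: (e b a) => //=; rewrite andbC.
have: connect r x y.
  by apply: connect_trans (to_z _ xk) _; rewrite sym_connect_sym // to_z.
case/connectP=> q pq lq; case/shortenP: pq lq => p pp up _ lp.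
exists p; split=> //; first by apply: sub_path pp => a b /and3P[].
rewrite /= xk /=; elim: p x {xk up lp} pp => //= a p IH x /andP[/and3P[_ _ ->]].
exact: IH.
Qed.

End Distance.

(** * Distances across an edge of a tree *)

Section Tree.
Variables (T : finType) (e : rel T).
Hypothesis tree_e : is_tree e.
Local Notation d := (dist e).

Let sym_e : symmetric e. Proof. by case: tree_e => -[]. Qed.
Let irr_e : irreflexive e. Proof. by case: tree_e => -[]. Qed.
Let conn_e : connected_graph e. Proof. by case: tree_e => _ []. Qed.
Let acyc_e : acyclic e. Proof. by case: tree_e => _ []. Qed.

(** Otherwise step from both ends to neighbours closer to [z] and join these below that level: a
    cycle through the edge [uw]. *)
Lemma tree_dist_edge_neq z u w : e u w -> d u z <> d w z.
Proof.
rewrite !(distC sym_e conn_e _ z) => euw duw.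
have [du0|du] := posnP (d z u).
  have zu := dist_eq0 conn_e du0.
  by move: euw; rewrite -zu -(@dist_eq0 _ _ conn_e z w) ?irr_e // -duw.
have [u' euu' Eu] := closer_neighbor sym_e conn_e du.
have [w' eww' Ew] : exists2 y, e w y & d z w = (d z y).+1.
  by apply: closer_neighbor; rewrite // -duw.
have w'k : d z w' < d z u by lia.
have u'k : d z u' < d z u by lia.
have [p [pp lp up ap]] := below_path sym_e conn_e w'k u'k.
suff: cycle e [:: u, w, w' & p].
  apply/negP; apply: acyc_e => //.
  have out x : d z x = d z u -> x \notin w' :: p.
    by move=> dx; apply/negP => /(allP ap); rewrite dx ltnn.
  rewrite 2!cons_uniq up out ?andbT // inE negb_or out // andbT.
  by apply/eqP => uw; move: euw; rewrite uw irr_e.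
rewrite (cycle_path u) /= -/(last w' p) lp sym_e euu' euw eww' /=.
by [].
Qed.

Lemma tree_closer_uniq z u v w :
  e u v -> e u w -> d v z < d u z -> d w z < d u z -> v = w.
Proof.
rewrite !(distC sym_e conn_e _ z) => euv euw dv dw.
have [//|nvw] := eqVneq v w.
have [p [pp lp up ap]] := below_path sym_e conn_e dv dw.
suff: cycle e [:: u, v & p].
  apply: contraTeq => _; apply: acyc_e.
    rewrite cons_uniq up andbT; apply/negP => /(allP ap).
    by rewrite ltnn.
  by case: p lp {pp up ap} nvw => //= ->; rewrite eqxx.
by rewrite (cycle_path u) /= lp sym_e euw euv.
Qed.

Lemma tree_dist_edge z u w : e u w -> d u z < d w z -> d w z = (d u z).+1.
Proof.
move=> euw; have := dist_edge conn_e z euw.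
by rewrite !(distC sym_e conn_e z); lia.
Qed.

(** The edge [uv] is the only one joining its two sides, so the crossing ends at [v]. *)
Lemma tree_cross u v x y : e u v -> d u x < d v x -> d v y < d u y ->
  cnbr e x y -> d u y <= 1.
Proof.
move=> euv ux vy /orP[/eqP yx|exy]; first by move: vy; rewrite yx; lia.
have Ev := tree_dist_edge euv ux.
have Eu : d u y = (d v y).+1 by apply: tree_dist_edge; rewrite // sym_e.
have duy := dist_edge conn_e u exy.
have dvx : d v x <= (d v y).+1 by apply: dist_edge; rewrite // sym_e.
have [|vy0] := posnP (d v y); first by lia.
have [t eyt Et] := closer_neighbor sym_e conn_e vy0.
have dut : d u t <= (d v t).+1.
  by rewrite !(distC sym_e conn_e _ t); apply: dist_edge; rewrite // sym_e.
(* [t] and [x] are neighbours of [y] closer to [u], hence equal; but [t] lies on the side of [v]. *)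
suff tx : t = x by move: Et; rewrite tx; lia.
apply: (@tree_closer_uniq u y) => //; rewrite 1?sym_e //.
  by rewrite !(distC sym_e conn_e _ u); lia.
by rewrite !(distC sym_e conn_e _ u); lia.
Qed.

(** * Branches at a vertex, and mouse moves between them *)

Lemma side u v x : e u v -> d u x < d v x \/ d v x < d u x.
Proof. by move/(tree_dist_edge_neq (z := x)) => /eqP; rewrite neq_ltn => /orP. Qed.

Lemma dist_step z x y : cnbr e x y -> d z y <= (d z x).+1.
Proof. by case/orP=> [/eqP->|/(dist_edge conn_e z)]. Qed.

(* For an edge uv, the branch of v at u is encoded as the set of vertices closer
   to v than to u: [off] means outside that branch up to depth j, and [near]
   means inside it up to distance j from u. *)
Definition off u v j x := d u x < d v x \/ d u x <= j.

Lemma off_step u v j x y : e u v -> off u v j x -> cnbr e x y -> off u v j.+1 y.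
Proof.
move=> euv ox xy; have [|vy] := side y euv; first by left.
right; case: ox => ox; first by have := tree_cross euv ox vy xy; lia.
by have := dist_step u xy; lia.
Qed.

Definition near u w j x := d w x < d u x \/ d u x <= j.

Lemma near_step u w j x y :
  e u w -> near u w j x -> cnbr e x y -> near u w j.+1 y.
Proof.
move=> euw nx xy; have [uy|] := side y euw; last by left.
right; have := dist_step u xy; case: nx => nx; last by lia.
(* The mouse can only leave the branch of w through u itself. *)
have ewu : e w u by rewrite sym_e.
by have := tree_cross ewu nx uy xy; lia.
Qed.

Lemma near_of_off u w j x : (forall v, e u v -> v != w -> off u v j x) ->
  near u w j x.
Proof.
move=> H; have [ux|/(closer_neighbor sym_e conn_e)[v euv Ev]] := posnP (d x u).
  by right; rewrite (distC sym_e conn_e) ux.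
have dvu : d v x < d u x by rewrite !(distC sym_e conn_e _ x) Ev.
have [<-|vw] := eqVneq v w; first by left.
by case: (H v euv vw); [lia | right].
Qed.

(* The positions still possible after probing c' when those possible at the
   previous probe c were K and the answer is b. *)
Definition after c c' b (K : T -> Prop) y :=
  exists x, [/\ K x, cnbr e x y & (d c' y <= d c x) = b].

(** In the branch of [v] or of [w], the distances from [y] to the two probes differ by 2, which one
    move of the mouse cannot offset; so the answer refutes one branch. *)
Lemma after_probe u v w b K y : e u v -> e u w -> v <> w -> after v w b K y ->
  d u y < d (if b then v else w) y.
Proof.
move=> euv euw vw [x [_ xy ans]].
have dvy := dist_step v xy.
have dvx : d v x <= (d v y).+1.
  by apply: dist_step; rewrite /cnbr sym_e eq_sym.
have far t : e u t -> d u y < d t y -> d t y = (d u y).+1.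
  exact: tree_dist_edge.
have [uv|vu] := side y euv; have [uw|wu] := side y euw.
- by case: (b).
- by have := far v euv uv; case: b ans; lia.
- by have := far w euw uw; case: b ans; lia.
- by case: vw; apply: tree_closer_uniq vu wu.
Qed.

(** Frees the search from histories: [K] bounds the possible positions at the current probe [c], and
    [n] rounds are left. The probe [c'] is fixed before its answer [b]. *)
Fixpoint win r n c (K : T -> Prop) : Prop :=
  (exists u, forall x, K x -> d u x <= r) \/
  (if n is n'.+1 then exists c', forall b, win r n' c' (after c c' b K)
   else False).

Lemma win_leq r n n' c K : n <= n' -> win r n c K -> win r n' c K.
Proof.
elim: n n' c K => [|n IH] [|n'] c K //= le; first by case=> //; left.
by case=> [?|[c' H]]; [left | right; exists c' => b; apply: IH].
Qed.

(* [s] lists the neighbours of [u] not yet compared with the champion [y]: each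
   comparison costs one round to return to [y] and one to probe the challenger.
   [Q] transports what was known before the scan. *)
Lemma win_scan r u (Q : nat -> T -> Prop) J n :
    (forall i x y, Q i x -> cnbr e x y -> Q i.+1 y) ->
  forall s y p i K,
    uniq (y :: s) -> {in y :: s, forall v, e u v} -> 2 * size s <= J.+2 ->
    (forall x, K x -> Q i x) ->
    (forall v, e u v -> v \notin y :: s ->
       exists2 j, j + 2 * size s <= J & forall x, K x -> off u v j x) ->
    (forall y' p' K', e u y' ->
       (forall x, K' x -> near u y' J x /\ Q (i + 2 * size s) x) ->
       win r n p' K') ->
  win r (2 * size s + n) p K.
Proof.
move=> Qstep; elim=> [|v s IH] y p i K us es sJ KQ Koff cont.
  rewrite add0n; apply: (cont y) => [|x Kx]; first by rewrite es ?mem_head.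
  split; last by rewrite addn0; apply: KQ.
  apply: near_of_off => w euw wy.
  have [|j jJ /(_ x Kx)] := Koff w euw; first by rewrite inE.
  by case=> ?; [left | right; lia].
have -> : 2 * size (v :: s) + n = (2 * size s + n).+2 by rewrite /=; lia.
(* The answer [b1] on returning to [y] is ignored; only the comparison of [y] with [v] counts. *)
right; exists y => b1; right; exists v => b.
have [yvs [vs us']] : y \notin v :: s /\ v \notin s /\ uniq s.
  by move: us; rewrite !cons_uniq => /and3P[].
have euy : e u y by rewrite es ?mem_head.
have euv : e u v by rewrite es ?inE ?eqxx ?orbT.
have es' : {in s, forall v, e u v} by move=> w ws; rewrite es ?inE ?ws ?orbT.
have yv : y <> v by move=> yv; move: yvs; rewrite yv mem_head.
apply: (IH (if b then v else y) _ i.+2).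
- by case: b; rewrite /= ?vs //; move: yvs; rewrite inE negb_or us' => /andP[_ ->].
- by move=> w; rewrite inE => /orP[/eqP ->|/es' //]; case: b.
- by move: sJ => /=; lia.
- move=> x [x1 [[x0 [Kx0 a0 _]] a1 _]].
  by apply: (Qstep _ x1) => //; apply: (Qstep _ x0) => //; apply: KQ.
(* The loser of this comparison starts at depth 0; earlier losers age by two rounds. *)
- move=> w euw wn; have [wE|wE] := eqVneq w (if b then y else v).
    exists 0; first by move: sJ => /=; lia.
    move=> x /(after_probe euy euv yv) lt; left; rewrite wE.
    by case: (b) lt.
  have [|j jJ jo] := Koff w euw.
    by move: wn wE; rewrite !inE !negb_or; case: (b) => /andP[-> ->] ->.
  exists j.+2; first by move: jJ => /=; lia.
  move=> x [x1 [[x0 [/jo o0 a0 _]] a1 _]].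
  by apply: off_step a1 => //; apply: off_step a0.
- move=> y' p' K' euy' H; apply: (cont y') => // x /H[? ?]; split=> //.
  by rewrite /= mulnS addnA addn2.
Qed.

(** The scan at [w] starts with [u] as champion. It either points back to [u] or moves one step away
    from [r], which can happen at most [h - d r w] times. *)
Lemma win_descend r J h u w p (K : T -> Prop) :
    e u w -> (forall x, d r x <= h) -> d r w = (d r u).+1 ->
    0 < 2 * (maxdeg e).-1 <= J.+2 ->
    (forall x, K x -> near u w J x) ->
  win (J + 2 * (maxdeg e).-1) ((h - d r w).+1 * (2 * (maxdeg e).-1)) p K.
Proof.
set D := 2 * (maxdeg e).-1; move=> euw rh rw /andP[D0 DJ].
have [k] := ubnP (h - d r w); elim: k u w p K euw rw => // k IH u w p K euw rw hk Knear.
have ewu : e w u by rewrite sym_e.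
pose s := enum ([set v | e w v] :\ u).
have mem_s v : (v \in s) = (v != u) && e w v by rewrite mem_enum !inE.
have szs : 2 * size s <= D.
  have : degree e w <= maxdeg e by apply: leq_bigmax.
  by rewrite /D /degree -cardE (cardsD1 u) inE ewu; lia.
rewrite mulSn; apply: (@win_leq _ (2 * size s + (h - d r w) * D)); first by lia.
(* The bound left by the scan at [u] weakens by one per round while [w] is scanned. *)
apply: (@win_scan _ w (fun i => near u w (J + i)) J _ _ s u p 0).
- by move=> i x y nx xy; rewrite addnS; apply: near_step nx xy.
- by rewrite cons_uniq enum_uniq mem_s eqxx.
- by move=> v; rewrite inE mem_s => /orP[/eqP->|/andP[]].
- exact: leq_trans szs DJ.
- by move=> x /Knear; rewrite addn0.
- by move=> v ewv; rewrite inE mem_s ewv; case: eqP.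
(* If the scan at [w] points back to [u], combining it with what the scan at [u]
   gave confines the mouse to a ball around [u]. *)
move=> y p' K' ewy K'near; have [yu|yu] := eqVneq y u.
  apply: (@win_leq _ 0) => //; left; exists u => x /K'near[].
  rewrite yu => n1 n2.
  have dux : d u x <= (d w x).+1.
    by rewrite !(distC sym_e conn_e _ x); apply: dist_edge.
  case: n2 => [wu|le]; first by case: n1; lia.
  by apply: leq_trans le _; rewrite add0n leq_add2l.
(* [u] is the only neighbour of [w] closer to [r], so any other winner lies farther out. *)
have ry : d r y = (d r w).+1.
  have [|lt] := side r ewy.
    by move/(tree_dist_edge ewy); rewrite !(distC sym_e conn_e _ r).
  case/eqP: yu; apply: (tree_closer_uniq ewy ewu lt).
  by rewrite !(distC sym_e conn_e _ r) rw.
have -> : h - d r w = (h - d r y).+1 by have := rh y; lia.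
apply: (IH _ _ _ _ ewy ry); first by have := rh y; lia.
by move=> x /K'near[].
Qed.

Lemma win_center h r : (forall x, d r x <= h) -> 2 <= maxdeg e ->
  win (4 * maxdeg e - 6) (h.+1 * (2 * (maxdeg e).-1)) r (fun=> True).
Proof.
move=> rh De.
have [y ery] : exists y, e r y.
  have [x rx] : exists x, x != r.
    apply/existsP; apply: contraLR De => /existsPn H; rewrite -leqNgt.
    apply: leq_trans (_ : 0 <= 1) => //; rewrite leqn0; apply/eqP/big1 => v _.
    rewrite /degree; apply/eqP; rewrite cards_eq0 -subset0; apply/subsetP => u.
    have /eqP-> := negPn (H u); have /eqP-> := negPn (H v).
    by rewrite !inE irr_e.
  have : 0 < d x r.
    by rewrite lt0n; apply: contra rx => /eqP/(dist_eq0 conn_e)->.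
  by case/(closer_neighbor sym_e conn_e) => y ery _; exists y.
set D := 2 * _; pose s := enum ([set v | e r v] :\ y).
have mem_s v : (v \in s) = (v != y) && e r v by rewrite mem_enum !inE.
have szs : 2 * size s <= D.
  have : degree e r <= maxdeg e by apply: leq_bigmax.
  by rewrite /D /degree -cardE (cardsD1 y) inE ery; lia.
rewrite mulSn; apply: (@win_leq _ (2 * size s + h * D)); first by lia.
(* The first loser ages through at most [maxdeg e - 2] later comparisons, two rounds each. *)
apply: (@win_scan _ r (fun _ _ => True) (2 * maxdeg e - 4) _ _ s y r 0) => //.
- by rewrite cons_uniq enum_uniq mem_s eqxx.
- by move=> v; rewrite inE mem_s => /orP[/eqP->|/andP[]].
- by apply: leq_trans szs _; rewrite /D; lia.
- by move=> v erv; rewrite inE mem_s erv; case: eqP.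
move=> w p K erw Knear.
have rw : d r w = (d r r).+1.
  have := dist_edge conn_e r erw; have := @dist_eq0 _ _ conn_e r w.
  rewrite dist0; case: (d r w) => [/(_ erefl) rw|[]//].
  by move: erw; rewrite rw irr_e.
have -> : 4 * maxdeg e - 6 = 2 * maxdeg e - 4 + D by rewrite /D; lia.
have -> : h = (h - d r w).+1 by have := rh w; rewrite rw dist0; lia.
apply: (win_descend _ erw rh rw); first by rewrite -/D /D; lia.
by move=> x /Knear[].
Qed.

(** * From the abstract search to strategies on bit sequences *)

Lemma pboolP (P : Prop) : reflect P (pbool P).
Proof. by rewrite /pbool; case: excluded_middle_informative; constructor. Qed.

Lemma Mset_step (m c : nat -> T) i x : 0 < i -> x \in Mset e m c i.+1 ->
  after (c i) (c i.+1) (bb e m c i.+1) (fun y => y \in Mset e m c i) x.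
Proof.
move=> i0; rewrite inE => /pboolP[mt [<- H]].
exists (mt i); have [|h1 h2] := H i.+1; first by lia.
split=> //.
rewrite inE; apply/pboolP.
by exists mt; split=> // j ij; apply: H; lia.
Qed.

Lemma radS_le (M : {set T}) u r : (forall x, x \in M -> d u x <= r) ->
  radS e M <= r.
Proof.
move=> H; rewrite /radS; pose F v := \max_(m in M) d v m.
have Fr : F u <= r by apply/bigmax_leqP.
apply: leq_trans Fr; rewrite -/(F _) (eq_bigr F) //; move: F => F.
elim: index_enum (mem_index_enum u) => // v s IH.
rewrite inE big_cons => /orP[/eqP->|/IH]; first exact: geq_minl.
exact: leq_trans (geq_minr _ _).
Qed.

(** [g] reads the answers given after round [i]: on the empty list it makes the next probe, and the
    first bit selects the strategy for the rest. *)
Lemma win_strategy r n c0 (K : T -> Prop) : win r n c0 K ->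
  exists g : seq bool -> T, forall (m c : nat -> T) i, 0 < i -> c i = c0 ->
    (forall x, x \in Mset e m c i -> K x) ->
    (forall k, c (i + k).+1 = g [seq bb e m c j | j <- iota i.+1 k]) ->
  exists j, i <= j <= i + n /\ radS e (Mset e m c j) <= r.
Proof.
elim: n c0 K => [|n IH] c0 K /= [[u Hu]|].
- exists (fun=> c0) => m c i _ _ MK _; exists i; split; first by lia.
  by apply: (@radS_le _ u) => x /MK/Hu.
- by [].
- exists (fun=> c0) => m c i _ _ MK _; exists i; split; first by lia.
  by apply: (@radS_le _ u) => x /MK/Hu.
case=> c' H; have [gt Ht] := IH _ _ (H true); have [gf Hf] := IH _ _ (H false).
exists (fun s => if s is b :: s' then (if b then gt else gf) s' else c').
move=> m c i i0 ci MK Hg.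
have ci1 : c i.+1 = c' by have := Hg 0; rewrite addn0.
have MK1 x : x \in Mset e m c i.+1 -> after c0 c' (bb e m c i.+1) K x.
  rewrite -ci -ci1 => /(Mset_step i0)[y [My yx b]].
  by exists y; split=> //; apply: MK.
have Hg1 k := Hg k.+1.
have [j [ij Mj]] : exists j, i.+1 <= j <= i.+1 + n /\ radS e (Mset e m c j) <= r.
  by case E : (bb e m c i.+1) in MK1 Hg1; [apply: Ht | apply: Hf] => // k;
     have := Hg1 k; rewrite addSnnS /= E.
by exists j; split=> //; lia.
Qed.

Lemma radius_center : 0 < #|T| -> exists r, forall x, d r x <= radius e.
Proof.
case/card_gt0P=> r0 _; rewrite /radius /radS.
(* Formally the minimum may be its seed [#|T|], but every distance is below that. *)
suff [E|[r E]] : \big[minn/#|T|]_u \max_(m in [set: T]) d u m = #|T| \/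
    exists r, \big[minn/#|T|]_u \max_(m in [set: T]) d u m
      = \max_(m in [set: T]) d r m.
- by exists r0 => x; rewrite E ltnW // dist_lt_card.
- by exists r => x; rewrite E; apply: leq_bigmax_cond; rewrite inE.
elim/big_rec: _ => [|u n _ IH]; first by left.
by case: leqP => // _; right; exists u.
Qed.

End Tree.

Theorem theorem1 :
  exists C : nat, 0 < C /\
    forall (T : finType) (e : rel T), is_tree e ->
      2 <= maxdeg e ->
      can_localize e (4 * maxdeg e - 6) (C * radius e * maxdeg e).
Proof.
(* With h the radius and D the maximum degree, the last round is at most 1 + 2(h + 1)(D - 1), and h
   + 1 <= 2h as h is positive. *)
exists 5; split=> // T e tree_e De.
have T0 : 0 < #|T|.
  rewrite lt0n; apply: contraL De => /eqP T0; rewrite -leqNgt /maxdeg big1 // => v.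
  by have := fintype0 v T0.
have [r rh] := radius_center tree_e T0.
have [g Hg] := win_strategy (win_center tree_e rh De).
exists r, (g [::]), g => m c _ [c1 [c2 cf]].
have [||k|j [j1 Mj]] := Hg m c 1 _ c1 => //.
  by case: k => [|k] //; rewrite add1n cf.
exists j; split=> //.
have rad0 : 0 < radius e.
  rewrite lt0n; apply/eqP => h0.
  have Tr x : x = r.
    apply/esym/(@dist_eq0 _ e); first by case: tree_e => _ [].
    by apply/eqP; rewrite -leqn0 -h0.
  move: De; rewrite /maxdeg big1 // => v _.
  apply/eqP; rewrite cards_eq0 -subset0; apply/subsetP => u.
  by rewrite !inE (Tr u) (Tr v); case: tree_e => -[_ ->].
nia.
Qed.
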